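(* Let $X$ be a compact metric space. If $X$ admits a pointwise positively recurrent homeomorphism $f:X\to X$ (i.e. every point of $X$ is positively recurrent for $f$) which is expansive and has the pseudo orbit tracing property, then $X$ is finite.
   Context: Let $f$ be a homeomorphism of a compact metric space $(X,d)$. A point $x\in X$ is positively recurrent if there are $0<n_1<n_2<\cdots$ with $f^{n_i}(x)\to x$. $f$ is expansive if there is $c>0$ such that $\sup_{n\in\mathbb{Z}} d(f^n(x),f^n(y))>c$ for all distinct $x,y\in X$. A sequence of points $\{x_i: a<i<b\}$ in $X$ (indexed by integers $i$, with $-\infty\le a<b\le+\infty$) is a $\delta$ pseudo orbit for $f$ if $d(f(x_i),x_{i+1})<\delta$ for each $i\in(a,b-1)$. A sequence $\{x_i:a<i<b\}$ is $\varepsilon$ traced by $x\in X$ if $d(f^i(x),x_i)<\varepsilon$ for each $i\in(a,b)$. The homeomorphism $f$ has the pseudo orbit tracing property if for every $\varepsilon>0$ there is $\delta>0$ such that every $\delta$ pseudo orbit for $f$ can be $\varepsilon$ traced by some point of $X$. *)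

(* Defs.v *)
From mathcomp Require Import all_boot all_order all_algebra.
From mathcomp Require Import all_classical all_reals all_analysis.

Set Implicit Arguments.
Unset Strict Implicit.
Unset Printing Implicit Defensive.

Import Order.TTheory GRing.Theory Num.Theory.

Local Open Scope classical_set_scope.
Local Open Scope ring_scope.

Record self_homeomorphism (X : topologicalType) := SelfHomeomorphism {
  homeo_fun :> X -> X ;
  homeo_inv : X -> X ;
  homeo_funK : cancel homeo_fun homeo_inv ;
  homeo_invK : cancel homeo_inv homeo_fun ;
  homeo_fun_continuous : continuous homeo_fun ;
  homeo_inv_continuous : continuous homeo_inv }.

(* Recall that [Negz n] denotes the integer [- n.+1]. *)
Definition homeo_iter (X : topologicalType) (f : self_homeomorphism X)
    (n : int) (x : X) : X :=
  match n with
  | Posz m => iter m f x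
  | Negz m => iter m.+1 (homeo_inv f) x
  end.

Definition positively_recurrent (X : topologicalType)
    (f : self_homeomorphism X) (x : X) : Prop :=
  exists n : nat -> nat,
    [/\ (0 < n 0)%N,
        {homo n : i j / (i < j)%N} &
        homeo_iter f (n i) x @[i --> \oo] --> x].

Definition expansive (R : realType) (X : metricType R)
    (f : self_homeomorphism X) : Prop :=
  exists2 c : R, 0 < c &
    forall x y : X, x <> y ->
      (c%:E < ereal_sup (range (fun n : int =>
                (mdist (homeo_iter f n x) (homeo_iter f n y))%:E)))%E.

(* The bounds [a] and [b] are extended integers. A sequence [{x_i : a < i < b}]
   is represented by a total function on [int] whose values outside [(a, b)]
   are irrelevant. *)
Definition pseudo_orbit (R : realType) (X : metricType R) (f : X -> X)
    (delta : R) (a b : \bar int) (x : int -> X) : Prop :=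
  forall i : int, (a < i%:E < b - 1)%E -> mdist (f (x i)) (x (i + 1)) < delta.

Definition traced_by (R : realType) (X : metricType R)
    (f : self_homeomorphism X) (eps : R) (a b : \bar int) (x : int -> X)
    (z : X) : Prop :=
  forall i : int, (a < i%:E < b)%E -> mdist (homeo_iter f i z) (x i) < eps.

Definition pseudo_orbit_tracing_property (R : realType) (X : metricType R)
    (f : self_homeomorphism X) : Prop :=
  forall eps : R, 0 < eps ->
    exists2 delta : R, 0 < delta &
      forall (a b : \bar int) (x : int -> X), (a < b)%E ->
        pseudo_orbit f delta a b x ->
        exists z : X, traced_by f eps a b x z.

(* Main.v *)
Require Import Defs.
From mathcomp Require Import all_boot all_order all_algebra.
From mathcomp Require Import all_classical all_reals all_analysis.
From mathcomp Require Import zify lra.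

(** Tracing a pseudo orbit that repeats a finite segment of a recurrent orbit
    forever gives, by expansiveness, a periodic point: the periodic points are
    dense ([closing_lemma]).  They are also uniformly separated
    ([periodic_points_separated]).  Indeed, let [p] and [q] be periodic points
    so close that following the orbit of [q] up to time 0 and that of [p] from
    time 0 on makes a pseudo orbit, and let [z] trace it.  In the future [z] is
    almost periodic because it follows [p]; since [z] returns arbitrarily close
    to itself, this almost periodicity holds at all times, and expansiveness
    turns it into periodicity ([recurrent_almost_periodic]).  But a periodic
    point which follows [p] in the future and [q] in the past follows both of
    them at all times, so [p = q].

    A dense uniformly separated set is the whole space, and a uniformly
    separated compact space is finite. *)

Set Implicit Arguments.
Unset Strict Implicit.

Import Order.TTheory GRing.Theory Num.Theory.

Local Open Scope classical_set_scope.
Local Open Scope ring_scope.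

(** * Integer iterates of a homeomorphism *)

Lemma homeo_iterS (X : topologicalType) (f : self_homeomorphism X) (i : int)
    (x : X) : homeo_iter f (i + 1) x = f (homeo_iter f i x).
Proof.
case: i => [n|[|n]]; first by rewrite /= addn1.
  by rewrite /= homeo_invK.
have -> : Negz n.+1 + 1 = Negz n by lia.
by rewrite /= homeo_invK.
Qed.

Lemma homeo_iterB1 (X : topologicalType) (f : self_homeomorphism X) (i : int)
    (x : X) : homeo_iter f (i - 1) x = homeo_inv f (homeo_iter f i x).
Proof. by rewrite -{2}(subrK 1 i) homeo_iterS homeo_funK. Qed.

Lemma homeo_iterD (X : topologicalType) (f : self_homeomorphism X) (i j : int)
    (x : X) : homeo_iter f (i + j) x = homeo_iter f i (homeo_iter f j x).
Proof.
elim/int_ind: i => [|n IHn|n IHn]; first by rewrite add0r.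
  have -> : n.+1%:Z + j = (n%:Z + j) + 1 by lia.
  by rewrite homeo_iterS IHn -homeo_iterS; congr homeo_iter; lia.
have -> : - n.+1%:Z + j = (- n%:Z + j) - 1 by lia.
by rewrite homeo_iterB1 IHn -homeo_iterB1; congr homeo_iter; lia.
Qed.

Lemma continuous_homeo_iter (X : topologicalType) (f : self_homeomorphism X)
    (i : int) : continuous (homeo_iter f i).
Proof.
have iter_cont (g : X -> X) n : continuous g -> continuous (iter n g).
  move=> gc; elim: n => [|n IHn] x; first exact: cvg_id.
  exact: (continuous_comp (IHn x) (gc _)).
by case: i => n; apply: iter_cont;
  [exact: homeo_fun_continuous | exact: homeo_inv_continuous].
Qed.

Lemma homeo_iter_modz (X : topologicalType) (f : self_homeomorphism X)
    (N i : int) (x : X) :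
  homeo_iter f N x = x -> homeo_iter f i x = homeo_iter f (i %% N)%Z x.
Proof.
move=> xN; have fixN k : homeo_iter f (k * N) x = x.
  elim/int_ind: k => [|n IHn|n IHn]; first by rewrite mul0r.
    have -> : n.+1%:Z * N = n%:Z * N + N by lia.
    by rewrite homeo_iterD xN.
  rewrite -[X in homeo_iter f _ X]xN -homeo_iterD.
  by have -> : - n.+1%:Z * N + N = - n%:Z * N by lia.
by rewrite {1}(divz_eq i N) addrC homeo_iterD fixN.
Qed.

(** * Expansiveness, recurrence and tracing in terms of distances *)

Lemma expansive_separation (R : realType) (X : metricType R)
    (f : self_homeomorphism X) : expansive f ->
  exists2 c : R, 0 < c & forall x y : X,
    (forall n, mdist (homeo_iter f n x) (homeo_iter f n y) <= c) -> x = y.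
Proof.
move=> [c c0 expc]; exists c => // x y xy; apply: contrapT => /expc.
rewrite ltNge => /negP; apply; apply: ge_ereal_sup => _ [n _ <-].
by rewrite lee_fin.
Qed.

Lemma pseudo_orbit_tracing_bi_infinite (R : realType) (X : metricType R)
    (f : self_homeomorphism X) (eps : R) :
  pseudo_orbit_tracing_property f -> 0 < eps ->
  exists2 delta : R, 0 < delta & forall x : int -> X,
    (forall i, mdist (f (x i)) (x (i + 1)) < delta) ->
    exists z, forall i, mdist (homeo_iter f i z) (x i) < eps.
Proof.
move=> ptp e0; have [d d0 tr] := ptp _ e0; exists d => // x xd.
have [//|i _|z zx] := tr -oo%E +oo%E x; first exact: xd.
by exists z => i; apply: zx; rewrite ltNyr ltry.
Qed.

Lemma recurrent_return (R : realType) (X : metricType R)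
    (f : self_homeomorphism X) (x : X) (P : set X) (m : nat) :
  positively_recurrent f x -> nbhs x P ->
  exists2 n : nat, (m < n)%N & P (homeo_iter f n%:Z x).
Proof.
move=> [n [n0 nmono ncvg]] xP.
have n_gt i : (i < n i)%N.
  by elim: i => // i IHi; apply: leq_ltn_trans IHi (nmono _ _ (ltnSn i)).
have [k _ nP] := ncvg _ xP.
exists (n (maxn k m)); last by apply: nP; rewrite /= leq_maxl.
exact: leq_ltn_trans (leq_maxr k m) (n_gt _).
Qed.

Lemma nbhs_mdist_lt (R : realType) (X : metricType R) (g : X -> X) (x : X)
    (e : R) : continuous g -> 0 < e -> \forall y \near x, mdist (g x) (g y) < e.
Proof.
by move=> gc e0; apply: metricType_numDomainType.cvgr_dist_lt => //; exact: gc.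
Qed.

(** * Density and separation of the periodic points *)

(** The point tracing a loop and its image by the [n]th iterate trace the same
    pseudo orbit, so that expansiveness identifies them. *)
Lemma closing_lemma (R : realType) (X : metricType R)
    (f : self_homeomorphism X) (x : X) (eps : R) :
  expansive f -> pseudo_orbit_tracing_property f ->
  positively_recurrent f x -> 0 < eps ->
  exists p : X, exists2 n : nat, (0 < n)%N &
    homeo_iter f n p = p /\ mdist p x < eps.
Proof.
move=> /expansive_separation[c c0 sepc] ptp xrec eps0.
(* two points tracing a pseudo orbit within [c / 2] stay within [c] *)
have e0 : 0 < Num.min eps (c / 2) by rewrite lt_min eps0 divr_gt0.
have [d d0 trace] := pseudo_orbit_tracing_bi_infinite ptp e0.
have /(recurrent_return 0 xrec)[n n0 xn] :=
  @nbhs_mdist_lt _ _ id x d (fun=> cvg_id) d0.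
have nz0 : n%:Z != 0 by lia.
pose u (i : int) := homeo_iter f (i %% n)%Z x.
have [i|p pu] := trace u.
  rewrite /u -homeo_iterS -(modzDml i).
  have r0 := modz_ge0 i nz0.
  have rn : (i %% n)%Z < n by apply: ltz_pmod; lia.
  have [rn1|rn1] := ltP ((i %% n)%Z + 1) n%:Z.
    have -> : (((i %% n)%Z + 1) %% n)%Z = (i %% n)%Z + 1.
      by apply: modz_small; apply/andP; split; lia.
    by rewrite mdistxx.
  have -> : (i %% n)%Z + 1 = n by lia.
  by rewrite modzz metric_sym.
exists p, n => //; split; last first.
  by have := pu 0; rewrite /u mod0z lt_min => /andP[].
apply: sepc => i; rewrite -homeo_iterD.
have := pu i; have := pu (i + n); rewrite /u modzDr !lt_min.
move=> /andP[_ h1] /andP[_]; rewrite metric_sym => h2.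
have := metric_triangle (homeo_iter f (i + n) p) (u i) (homeo_iter f i p).
rewrite /u; lra.
Qed.

(** Every time [k] is approximated by the large positive times [k + m] with [m]
    a return time of [z], so the hypothesis, which concerns nonnegative times
    only, propagates to all times. *)
Lemma recurrent_almost_periodic (R : realType) (X : metricType R)
    (f : self_homeomorphism X) (c : R) (z : X) (N : int) :
  0 < c ->
  (forall x y : X,
    (forall n, mdist (homeo_iter f n x) (homeo_iter f n y) <= c) -> x = y) ->
  positively_recurrent f z ->
  (forall i : int, 0 <= i ->
    mdist (homeo_iter f i z) (homeo_iter f (i + N) z) <= c / 2) ->
  homeo_iter f N z = z.
Proof.
move=> c0 sepc zrec zN; apply/esym/sepc => k.
have c4 : 0 < c / 4 by rewrite divr_gt0.
have near_z : nbhs z [set y |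
    mdist (homeo_iter f k z) (homeo_iter f k y) < c / 4 /\
    mdist (homeo_iter f (k + N) z) (homeo_iter f (k + N) y) < c / 4].
  apply: filterI.
    exact: (nbhs_mdist_lt z (@continuous_homeo_iter _ f k) c4).
  exact: (nbhs_mdist_lt z (@continuous_homeo_iter _ f (k + N)) c4).
have [m km [h1 h2]] := recurrent_return `|k|%N zrec near_z.
have := zN (k + m); rewrite homeo_iterD addrAC (homeo_iterD f (k + N)).
have -> : 0 <= k + m by lia.
move=> /(_ isT) h3; rewrite metric_sym in h2.
rewrite -homeo_iterD.
set a := homeo_iter f k z in h1 *.
set b := homeo_iter f k _ in h1 h3.
set b' := homeo_iter f (k + N) _ in h2 h3.
set a' := homeo_iter f (k + N) z in h2 *.
have := metric_triangle a b a'; have := metric_triangle b b' a'; lra.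
Qed.

(** The tracing point [z] inherits the common period [N] of [p] and [q].  For
    points of period [N] every time is equivalent to a nonnegative one, when
    [z] is close to [p], and to a negative one, when [z] is close to [q]. *)
Lemma periodic_points_separated (R : realType) (X : metricType R)
    (f : self_homeomorphism X) :
  expansive f -> pseudo_orbit_tracing_property f ->
  (forall x : X, positively_recurrent f x) ->
  exists2 delta : R, 0 < delta & forall (p q : X) (m n : nat),
    (0 < m)%N -> (0 < n)%N -> homeo_iter f m p = p -> homeo_iter f n q = q ->
    mdist p q < delta -> p = q.
Proof.
move=> /expansive_separation[c c0 sepc] ptp rec.
(* two points that trace the orbit of [p] within [c / 4] stay within [c / 2],
   and extending this closeness from the future to all times costs [c / 2] *)
have c4 : 0 < c / 4 by rewrite divr_gt0.
have [d d0 trace] := pseudo_orbit_tracing_bi_infinite ptp c4.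
exists d => // p q m n m0 n0 pm qn pq.
pose N : int := (m * n)%N.
have N0 : 0 < N by rewrite /N; lia.
have pN : homeo_iter f N p = p.
  by rewrite (homeo_iter_modz _ pm) /N PoszM modzMr.
have qN : homeo_iter f N q = q.
  by rewrite (homeo_iter_modz _ qn) /N PoszM modzMl.
pose u (i : int) := homeo_iter f i (if i < 0 then q else p).
have [i|z zu] := trace u.
  rewrite /u -homeo_iterS; have [i0|i0] := ltP i 0; last first.
    by rewrite ifF ?mdistxx //; lia.
  have [i1|i1] := ltP (i + 1) 0; first by rewrite mdistxx.
  have -> : i + 1 = 0 by lia.
  by rewrite /= metric_sym.
have zN : homeo_iter f N z = z.
  apply: (recurrent_almost_periodic c0 sepc (rec z)) => i i0.
  have := zu (i + N); have := zu i; rewrite /u !ifF; [|lia|lia].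
  rewrite (homeo_iterD f i N p) pN => h1 h2; rewrite metric_sym in h2.
  have := metric_triangle (homeo_iter f i z) (homeo_iter f i p)
    (homeo_iter f (i + N) z); lra.
apply: sepc => k.
have r0 : 0 <= (k %% N)%Z by apply: modz_ge0; lia.
have rN : (k %% N)%Z < N by apply: ltz_pmod.
(* the nonnegative time is [k %% N] and the negative one is [k %% N - N] *)
have zp : mdist (homeo_iter f k z) (homeo_iter f k p) < c / 4.
  rewrite (homeo_iter_modz k zN) (homeo_iter_modz k pN).
  by have := zu (k %% N)%Z; rewrite /u ifF //; lia.
have shift x : homeo_iter f N x = x ->
    homeo_iter f k x = homeo_iter f ((k %% N)%Z - N) x.
  move=> xN; rewrite (homeo_iter_modz k xN).
  by rewrite -{2}xN -homeo_iterD subrK.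
have zq : mdist (homeo_iter f k z) (homeo_iter f k q) < c / 4.
  rewrite (shift _ zN) (shift _ qN).
  by have := zu ((k %% N)%Z - N); rewrite /u ifT //; lia.
have := metric_triangle (homeo_iter f k p) (homeo_iter f k z)
  (homeo_iter f k q).
rewrite metric_sym in zp; lra.
Qed.

(** * Finiteness *)

(** A separated dense set is the whole space: the points of the set that
    approximate a given point are eventually all equal. *)
Lemma separated_dense_setT (R : realType) (X : metricType R) (A : set X)
    (delta : R) : 0 < delta ->
  (forall p q, A p -> A q -> mdist p q < delta -> p = q) ->
  (forall x e, 0 < e -> exists2 p, A p & mdist p x < e) ->
  A = [set: X].
Proof.
move=> d0 sep dense; rewrite -subTset => x _.
have d2 : 0 < delta / 2 by rewrite divr_gt0.
have [p Ap px] := dense x _ d2.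
have [->//|px0] := eqVneq x p.
have e0 : 0 < Num.min (delta / 2) (mdist p x).
  by rewrite lt_min d2 mdist_gt0 eq_sym.
have [q Aq] := dense x _ e0; rewrite lt_min => /andP[qx qpx].
have pq : p = q.
  apply: sep => //; rewrite (le_lt_trans (metric_triangle p x q))//.
  by rewrite (metric_sym x); lra.
by move: qpx; rewrite pq ltxx.
Qed.

(** On an infinite space the cofinite filter would have a cluster point, and
    every neighbourhood of that point would contain another point. *)
Lemma compact_separated_finite (R : realType) (X : metricType R) (delta : R) :
  compact [set: X] -> 0 < delta ->
  (forall x y : X, mdist x y < delta -> x = y) -> finite_set [set: X].
Proof.
move=> cX d0 sep; apply: contrapT => infX.
pose F : set_system X := fun A => finite_set (~` A).
have FF : ProperFilter F.
  split; first by rewrite /F setC0.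
  split; first by rewrite /F setCT.
    by move=> A B; rewrite /F setCI finite_setU.
  by move=> A B AB; apply: sub_finite_set; apply: subsetC.
have [x [_ clx]] : [set: X] `&` cluster F !=set0.
  by apply: cX; rewrite /F setCT.
have Fx : F (~` [set x]) by rewrite /F setCK.
have [y [yx xy]] := clx _ _ Fx
  (nbhs_mdist_lt x (fun=> cvg_id) d0 : nbhs x [set y | mdist x y < delta]).
by apply: yx; rewrite /= (sep x y).
Qed.

Theorem corollary1p4 (R : realType) (X : metricType R) :
  compact [set: X] ->
  (exists f : self_homeomorphism X,
    [/\ forall x : X, positively_recurrent f x,
        expansive f &
        pseudo_orbit_tracing_property f]) ->
  finite_set [set: X].
Proof.
move=> cX [f [rec exp ptp]].
have [d d0 sep] := periodic_points_separated exp ptp rec.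
pose P := [set p | exists2 n : nat, (0 < n)%N & homeo_iter f n p = p].
have sepP p q : P p -> P q -> mdist p q < d -> p = q.
  by move=> [m m0 pm] [n n0 qn]; apply: (sep p q m n).
have PT : P = [set: X].
  apply: (separated_dense_setT d0 sepP) => x e e0.
  have [p [n n0 [pn px]]] := closing_lemma exp ptp (rec x) e0.
  by exists p => //; exists n.
by apply: (compact_separated_finite cX d0) => x y; apply: sepP; rewrite PT.
Qed.
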